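(* Let $m$ be a positive integer. Every Ferrers board is $m$-weight file equivalent to a unique $m$-restricted board.
   Context: Ferrers boards are written $B=(b_0,b_1,\dots,b_n)$ with $b_0=0\le b_1\le\dots\le b_n$ integers, $B$ being the set of the $b_j$ lowest cells of column $j$ in the quadrant grid (boards are sets of cells, so adding left columns of height $0$ gives the same board). A file placement on $B$ is a set of cells (rooks) no two in the same column. For a file placement $F$ with $y_i$ rooks in row $i$, $\mathrm{wt}_m F=\prod_i 1\downarrow_{y_i,m}$ where $x\downarrow_{y,m}=x(x-m)\cdots(x-(y-1)m)$, $x\downarrow_{0,m}=1$; $f_{k,m}(B)$ is the sum of $\mathrm{wt}_m F$ over file placements with $k$ rooks. Boards $B,B'$ are $m$-weight file equivalent if $f_{k,m}(B)=f_{k,m}(B')$ for all $k\ge0$. $B$ is $m$-restricted if $b_{j+1}\le b_j+m$ for all $j\ge0$. *)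

(* Defs.v *)
From mathcomp Require Import all_boot all_order all_algebra.

Set Implicit Arguments.
Unset Strict Implicit.
Unset Printing Implicit Defensive.

Import GRing.Theory.
Local Open Scope ring_scope.

(* The board (b_0, ..., b_n) is the sequence of its column heights; the
   sequence is nonempty, with b_0 = 0. *)
Definition ferrers_board (B : seq nat) : Prop :=
  [/\ (0 < size B)%N, nth 0%N B 0%N = 0%N & sorted leq B].

(* A board is a set of cells, so sequences which differ only by columns of
   height 0 on the left describe the same board. *)
Definition same_board (B B' : seq nat) : Prop :=
  exists p q : nat, nseq p 0%N ++ B = nseq q 0%N ++ B'.

(* A cell is a pair (column, row), counted from 0. The heights increase
   weakly, so all the cells lie in the first (last 0 B) rows. *)
Notation cell B := ('I_(size B) * 'I_(last 0%N B))%type.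

Definition cells (B : seq nat) : {set cell B} :=
  [set c : cell B | (c.2 < nth 0%N B c.1)%N].

Definition file_placement (B : seq nat) (F : {set cell B}) : bool :=
  (F \subset cells B) &&
  [forall c in F, forall d in F, (c.1 == d.1) ==> (c == d)].

Definition row_rooks (B : seq nat) (F : {set cell B}) (i : 'I_(last 0%N B)) :
  nat := #|[set c in F | c.2 == i]|.

(* x (x - m) ... (x - (y - 1) m) *)
Definition falling (m : nat) (x : int) (y : nat) : int :=
  \prod_(i < y) (x - (i * m)%N%:Z).

Definition wt (m : nat) (B : seq nat) (F : {set cell B}) : int :=
  \prod_(i < last 0%N B) falling m 1 (row_rooks F i).

Definition file_number (m k : nat) (B : seq nat) : int :=
  \sum_(F : {set cell B} | file_placement F && (#|F| == k)) wt m F.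

Definition weight_file_equiv (m : nat) (B B' : seq nat) : Prop :=
  forall k : nat, file_number m k B = file_number m k B'.

Definition m_restricted (m : nat) (B : seq nat) : Prop :=
  forall j : nat, (j.+1 < size B)%N -> (nth 0%N B j.+1 <= nth 0%N B j + m)%N.

(* Main.v *)
(** Adding a column of height [b] to the right of a sorted board, and in it a
    rook to a placement with [y_i] rooks in row [i] and [k] rooks in total,
    multiplies the weight by [1 - m y_i] if the new rook is in row [i]; the
    sum over [i < b] is [b - k m] because all the rooks lie below [b]. Hence the file numbers of a sorted
    board with [n] columns are the coordinates of
    [prod_(i < n) ('X - (i m - b_i))] in the basis of the falling factorials
    with step [m], and boards with the same number of columns are equivalent
    iff they have the same multiset of roots [i m - b_i]. A board is
    [m]-restricted iff its roots, read from left to right, increase weakly;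
    so an [m]-restricted board is determined by its roots, and it is obtained
    by sorting them once enough empty columns have made all of them
    nonnegative. *)

Require Import Defs.
From mathcomp Require Import all_boot all_order all_algebra.
From mathcomp Require Import zify ring.

Set Implicit Arguments.
Unset Strict Implicit.
Unset Printing Implicit Defensive.
Import Order.TTheory GRing.Theory Num.Theory.
Local Open Scope ring_scope.

(** * File numbers column by column *)

Definition add_column (m : nat) (c : nat -> int) (b : nat) (k : nat) : int :=
  c k + (if k is k'.+1 then (b%:Z - (k' * m)%N%:Z) * c k' else 0).

Definition file_coef (m : nat) (s : seq nat) : nat -> int :=
  foldl (add_column m) (fun k => (k == 0%N)%:Z) s.

Lemma file_coef_rcons (m : nat) (s : seq nat) (b : nat) :
  file_coef m (rcons s b) = add_column m (file_coef m s) b.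
Proof. by rewrite /file_coef foldl_rcons. Qed.

Section Recurrence.
Variables (m : nat) (B : seq nat).

Lemma falling_recr (x : int) (y : nat) :
  falling m x y.+1 = falling m x y * (x - (y * m)%N%:Z).
Proof. by rewrite /falling big_ord_recr. Qed.

(** Bounding the columns of placements on the fixed board [B], instead of truncating [B], keeps the
    type [cell B] constant in the induction on [j]. *)
Definition left_of (j : nat) (F : {set cell B}) : bool :=
  [forall c in F, (c.1 < j)%N].

Definition left_file_number (j k : nat) : int :=
  \sum_(F : {set cell B} | [&& file_placement F, left_of j F & #|F| == k])
    wt m F.

Lemma left_ofP (j : nat) (F : {set cell B}) :
  reflect (forall c, c \in F -> (c.1 < j)%N) (left_of j F).
Proof. exact: forall_inP. Qed.

Lemma file_placementP (F : {set cell B}) :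
  reflect ((forall c, c \in F -> (c.2 < nth 0%N B c.1)%N) /\
           (forall c d, c \in F -> d \in F -> c.1 = d.1 -> c = d))
          (file_placement F).
Proof.
apply: (iffP andP) => [[/subsetP sF /forall_inP uF]|[sF uF]].
  split=> [c /sF|c d cF dF e]; first by rewrite inE.
  have /forall_inP/(_ d dF) := uF c cF.
  by rewrite e eqxx => /eqP.
split; first by apply/subsetP => c /sF; rewrite inE.
apply/forall_inP => c cF; apply/forall_inP => d dF; apply/implyP => /eqP e.
by apply/eqP/uF.
Qed.

Lemma file_number_left (k : nat) :
  file_number m k B = left_file_number (size B) k.
Proof.
apply: eq_bigl => F; congr (_ && _).
by have -> : left_of (size B) F by apply/left_ofP => c _.
Qed.

Lemma left_file_number0 (k : nat) : left_file_number 0 k = (k == 0%N)%:Z.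
Proof.
rewrite /left_file_number.
have p0 : file_placement (set0 : {set cell B}).
  by apply/file_placementP; split=> c; rewrite inE.
have w0 : wt m (set0 : {set cell B}) = 1.
  rewrite /wt big1 // => i _; rewrite /row_rooks.
  rewrite (_ : [set c in set0 | c.2 == i] = set0) ?cards0 /falling ?big_ord0 //.
  by apply/setP => c; rewrite !inE.
have l0 F : left_of 0 F = (F == set0).
  apply/left_ofP/eqP => [lF|-> c]; last by rewrite inE.
  by apply/setP => c; rewrite inE; apply/negP => /lF.
case: k => [|k] /=.
  rewrite (big_pred1 set0) // => F; rewrite l0 /=.
  by case: eqP => [->|]; rewrite ?andbF // p0 cards0.
rewrite big_pred0 // => F; rewrite l0.
by case: eqP => [->|]; rewrite ?andbF // p0 cards0.
Qed.

Lemma row_rooksU1 (c : cell B) (F : {set cell B}) (i : 'I_(last 0%N B)) :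
  c \notin F -> row_rooks (c |: F) i = ((c.2 == i) + row_rooks F i)%N.
Proof.
move=> cF; rewrite /row_rooks; case: (eqVneq c.2 i) => ci.
  rewrite (_ : [set d in _ | _] = c |: [set d in F | d.2 == i]).
    by rewrite cardsU1 inE (negPf cF).
  apply/setP => d; rewrite !inE.
  by case: (eqVneq d c) => // ->; rewrite ci eqxx.
congr #|pred_of_set _|; apply/setP => d; rewrite !inE.
by case: (eqVneq d c) => // ->; rewrite (negPf ci) (negPf cF).
Qed.

Lemma wtU1 (c : cell B) (F : {set cell B}) :
  c \notin F -> wt m (c |: F) = wt m F * (1 - (row_rooks F c.2 * m)%N%:Z).
Proof.
move=> cF; rewrite /wt (bigD1 c.2) //= [in RHS](bigD1 c.2) //=.
rewrite row_rooksU1 // eqxx add1n falling_recr.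
rewrite (eq_bigr (fun i => falling m 1 (row_rooks F i))); first by ring.
by move=> i ic; rewrite row_rooksU1 // eq_sym (negPf ic).
Qed.

(** Used to evaluate the sum over rows [i < h] of [1 - m y_i], where only the total number of rooks
    survives. *)
Lemma sum_row_rooks (F : {set cell B}) (h : nat) :
  (forall c, c \in F -> (c.2 < h)%N) ->
  (\sum_(i < last 0 B | i < h) row_rooks F i = #|F|)%N.
Proof.
move=> hF; rewrite -sum1_card.
rewrite (partition_big (fun c : cell B => c.2) (fun i => i < h)%N) //=.
apply: eq_bigr => i _; rewrite /row_rooks -sum1_card.
by apply: eq_bigl => c; rewrite inE.
Qed.


Lemma left_file_numberS (j k : nat) :
  (j < size B)%N -> sorted leq B ->
  left_file_number j.+1 k = add_column m (left_file_number j) (nth 0%N B j) k.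
Proof.
move=> jB sB; pose jo : 'I_(size B) := Ordinal jB.
have le_nth i l : (i <= l < size B)%N -> (nth 0 B i <= nth 0 B l)%N.
  by move=> /andP[il lB]; apply: sorted_leq_nth => //;
    rewrite ?inE //; [exact: leq_trans|exact: leq_ltn_trans lB].
(* The placements split according to whether column [j] is empty; the empty case gives the first
   summand of [add_column]. *)
rewrite /left_file_number (bigID (fun F : {set cell B} => left_of j F)) /=.
rewrite /add_column; congr (_ + _).
  apply: eq_bigl => F; case lF: (left_of j F); last by rewrite !andbF.
  rewrite andbT (_ : left_of j.+1 F) //; apply/left_ofP => c.
  by move/(left_ofP _ _ lF); apply: ltnW.
have meetsP F : file_placement F && left_of j.+1 F ->
    reflect (exists i, (jo, i) \in F) (~~ left_of j F).
  move=> /andP[/file_placementP[_ uF] /left_ofP lF].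
  apply: (iffP idP) => [|[i iF]]; last first.
    by apply/negP => /left_ofP/(_ _ iF); rewrite ltnn.
  rewrite /left_of negb_forall_in => /exists_inP[[c i] cF /= jc].
  exists i; rewrite (_ : jo = c) //; apply/val_inj/eqP => /=.
  by rewrite eqn_leq (leqNgt j) jc -ltnS (lF _ cF).
case: k => [|k].
  rewrite big_pred0 // => F; apply/negP => /andP[/and3P[_ _ F0]] /negP; apply.
  by apply/left_ofP => c; move: F0; rewrite cards_eq0 => /eqP ->; rewrite inE.
(* Column [j] holds exactly one rook, so this inner sum has a single term; exchanging the sums then
   fixes the row [i] of that rook. *)
rewrite (eq_bigr (fun F : {set cell B} =>
  \sum_(i | (jo, i) \in F) wt m F)); last first.
  move=> F /andP[/and3P[pF lF _]] nF.
  have /meetsP/(_ nF)[i iF] : file_placement F && left_of j.+1 F by rewrite pF.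
  rewrite (big_pred1 i) // => l; apply/idP/eqP => [lF'|-> //].
  by have /file_placementP[_ /(_ _ _ lF' iF erefl)[]] := pF.
rewrite (exchange_big_dep xpredT) //=.
rewrite (bigID (fun i : 'I__ => i < nth 0 B j)%N) /= addrC.
rewrite big1 ?add0r; last first.
  move=> i bi; rewrite big_pred0 // => F; apply/negP.
  case/andP => /andP[/and3P[/file_placementP[cF _] _ _] _] /cF /=.
  by rewrite (negPf bi).
pose P (F : {set cell B}) := [&& file_placement F, left_of j F & #|F| == k].
have notin i F : P F -> (jo, i) \notin F.
  by case/and3P => _ /left_ofP lF _; apply/negP => /lF; rewrite ltnn.
(* Sortedness enters here: a rook further left is under the top of its own column, hence below the
   height of column [j]. *)
have below F : P F -> forall c, c \in F -> (c.2 < nth 0 B j)%N.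
  case/and3P => /file_placementP[cF _] /left_ofP lF _ c cinF.
  by apply: leq_trans (cF _ cinF) (le_nth _ _ _); rewrite ltnW ?lF.
transitivity (\sum_(i < last 0%N B | (i < nth 0 B j)%N) \sum_(F | P F)
    wt m F * (1 - (row_rooks F i * m)%N%:Z)).
  apply: eq_bigr => i ib.
  (* Adding and removing the rook [(jo, i)] are inverse bijections between the placements in [P] and
     those with this rook. *)
  rewrite (reindex_onto (fun F => (jo, i) |: F)
    (fun F => F :\ (jo, i))) /=; last first.
    by move=> F /andP[_ iF]; rewrite setD1K.
  apply: eq_big => [F|F /andP[_ /eqP FK]]; last first.
    by rewrite wtU1 // -FK !inE eqxx.
  rewrite setU11 andbT.
  apply/idP/idP => [|PF].
    case/andP => /andP[/and3P[/file_placementP[cF uF] /left_ofP lF FS] _].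
    move=> /eqP FK.
    have iF : (jo, i) \notin F by rewrite -FK !inE eqxx.
    have inF c : c \in F -> c \in (jo, i) |: F.
      by rewrite !inE => ->; rewrite orbT.
    apply/and3P; split.
    - apply/file_placementP; split=> [c /inF/cF //|c d /inF Fc /inF Fd].
      exact: uF.
    - apply/left_ofP => c Fc; have := lF _ (inF _ Fc).
      rewrite ltnS leq_eqVlt => /orP[/eqP cj|//].
      have e : jo = c.1 by apply/val_inj.
      by move: iF; rewrite (uF (jo, i) c) ?setU11 ?inF // Fc.
    - by move: FS; rewrite cardsU1 iF eqSS.
  have iF := notin i F PF.
  have [/file_placementP[cF uF] /left_ofP lF FS] := and3P PF.
  have ne c : c \in F -> jo <> c.1 by move=> /lF + e; rewrite -e ltnn.
  rewrite setU1K // eqxx andbT; apply/andP; split; last first.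
    by apply/negP => /left_ofP/(_ _ (setU11 _ _)); rewrite ltnn.
  apply/and3P; split.
  - apply/file_placementP; split=> [c|c d].
      by rewrite !inE => /orP[/eqP ->|/cF].
    rewrite !inE => /orP[/eqP ->|Fc] /orP[/eqP ->|Fd] //= e.
    + by case: (ne d Fd).
    + by case: (ne c Fc).
    + exact: uF.
  - apply/left_ofP => c; rewrite !inE => /orP[/eqP -> //|/lF]; exact: ltnW.
  - by rewrite cardsU1 iF eqSS.
rewrite exchange_big /= mulr_sumr; apply: eq_bigr => F PF.
rewrite -mulr_sumr mulrC; congr (_ * _).
(* Hence exactly [nth 0 B j] of the available rows lie below the top of column [j]. *)
have bN : (nth 0 B j <= last 0 B)%N.
  by rewrite -nth_last le_nth //; lia.
rewrite big_split sumrN /= -(big_ord_widen _ (fun=> 1) bN) sumr_const card_ord.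
rewrite natz -(big_morph Posz PoszD erefl) -big_distrl /=.
rewrite sum_row_rooks; last exact: below.
by case/and3P: PF => _ _ /eqP ->.
Qed.

Lemma left_file_number_coef (j : nat) : (j <= size B)%N -> sorted leq B ->
  left_file_number j =1 file_coef m (take j B).
Proof.
move=> + sB; elim: j => [_ k|j IHj jB k].
  by rewrite take0 left_file_number0.
rewrite left_file_numberS // (take_nth 0%N) // file_coef_rcons /add_column.
by rewrite !IHj ?(ltnW jB) //; case: k => // k; rewrite IHj ?(ltnW jB).
Qed.

Lemma file_number_coef (k : nat) :
  sorted leq B -> file_number m k B = file_coef m B k.
Proof.
by move=> sB; rewrite file_number_left left_file_number_coef ?take_size.
Qed.

End Recurrence.

Lemma eq_foldl_add_column (m : nat) (s : seq nat) (c d : nat -> int) :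
  c =1 d -> foldl (add_column m) c s =1 foldl (add_column m) d s.
Proof.
elim: s c d => [|b s IHs] c d cd //=; apply: IHs => k.
by rewrite /add_column cd; case: k => // k; rewrite cd.
Qed.

(** The initial function is nonzero only at [0], where a column of height 0 contributes the factor
    [0 - 0 * m]. *)
Lemma file_coef_cons0 (m : nat) (s : seq nat) :
  file_coef m (0%N :: s) =1 file_coef m s.
Proof.
rewrite /file_coef /=; apply: eq_foldl_add_column => -[|[|k]];
  rewrite /add_column /= ?addr0 //.
by rewrite mulr0.
Qed.

Lemma file_coef_pad (m p : nat) (s : seq nat) :
  file_coef m (nseq p 0%N ++ s) =1 file_coef m s.
Proof. by elim: p => //= p IHp k; rewrite file_coef_cons0. Qed.

Lemma file_coef_eq0 (m : nat) (s : seq nat) (k : nat) :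
  (size s < k)%N -> file_coef m s k = 0.
Proof.
elim/last_ind: s k => [|s b IHs] [|k] //; rewrite size_rcons ltnS => sk.
by rewrite file_coef_rcons /add_column !IHs ?mulr0 // ltnW.
Qed.

(** * Factorization in the falling factorial basis *)

Definition falling_poly (m n : nat) : {poly int} :=
  \prod_(i < n) ('X - ((i * m)%N%:Z)%:P).

Definition board_roots (m : nat) (s : seq nat) : seq int :=
  [seq (i * m)%N%:Z - (nth 0%N s i)%:Z | i <- iota 0 (size s)].

Lemma board_roots_rcons (m : nat) (s : seq nat) (b : nat) :
  board_roots m (rcons s b) =
  rcons (board_roots m s) ((size s * m)%N%:Z - b%:Z).
Proof.
rewrite /board_roots size_rcons -[in LHS]addn1 iotaD map_cat add0n /= cats1.
rewrite nth_rcons ltnn eqxx; congr rcons; apply/eq_in_map => i.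
by rewrite mem_iota nth_rcons => /andP[_ ->].
Qed.

(** For a new column of height [b] after [n] others, the linear factor splits as
    [(X - (n - k) m) + (b - k m)]: the first part extends [falling_poly m (n - k)] by one factor,
    the second is the multiplier in [add_column]. *)
Lemma sum_file_coef (m : nat) (s : seq nat) :
  \sum_(k < (size s).+1) file_coef m s k *: falling_poly m (size s - k) =
  \prod_(r <- board_roots m s) ('X - r%:P).
Proof.
elim/last_ind: s => [|s b IHs].
  by rewrite big_ord1 /board_roots big_nil /falling_poly big_ord0 scale1r.
rewrite board_roots_rcons -[rcons (board_roots _ _) _]cats1 big_cat big_seq1.
rewrite -IHs size_rcons.
set n := size s; rewrite [RHS]mulr_suml.
rewrite (eq_bigr (fun k : 'I_n.+2 =>
  file_coef m s k *: falling_poly m (n.+1 - k) +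
  (if (k : nat) is k'.+1 then
     ((b%:Z - (k' * m)%N%:Z) * file_coef m s k') *: falling_poly m (n - k')
   else 0))); last first.
  move=> k _; rewrite file_coef_rcons /add_column.
  by case: k => -[|k] lk /=; rewrite ?addr0 // scalerDl subSS.
(* In the first sum the term [k = n + 1] vanishes, as [s] has only [n] columns; the second sum is
   shifted by one. *)
rewrite big_split /= big_ord_recr /= file_coef_eq0 // scale0r addr0.
rewrite [X in _ + X]big_ord_recl /= add0r -big_split; apply: eq_bigr => k _.
have kn : (k <= n)%N by rewrite -ltnS.
rewrite subSn // {1}/falling_poly big_ord_recr -/(falling_poly m (n - k)) /=.
have -> : (n * m = (n - k) * m + k * m)%N by rewrite -mulnDl subnK.
rewrite add0n PoszD -!mul_polyC !polyCM !polyCB polyCD.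
ring.
Qed.

Lemma size_falling_poly (m n : nat) : size (falling_poly m n) = n.+1.
Proof. by rewrite size_prod_XsubC -[in RHS](card_ord n) cardE enumT. Qed.

(** [falling_poly m n] is monic of degree [n] and the earlier ones have smaller degree, so the
    coefficient of degree [n] isolates [e n]. *)
Lemma falling_poly_free (m n : nat) (e : nat -> int) :
  \sum_(j < n) e j *: falling_poly m j = 0 ->
  forall j, (j < n)%N -> e j = 0.
Proof.
elim: n => [//|n IHn]; rewrite big_ord_recr /= => sum0.
suff en : e n = 0.
  move: sum0; rewrite en scale0r addr0 => /IHn e0 j.
  by rewrite ltnS leq_eqVlt => /orP[/eqP ->|/e0].
have /(congr1 (fun p : {poly int} => p`_n)) := sum0.
rewrite coefD coefZ coef0 coef_sum big1 ?add0r; last first.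
  move=> i _; rewrite coefZ nth_default ?mulr0 //.
  by rewrite size_falling_poly.
have /monicP : falling_poly m n \is monic by apply: monic_prod_XsubC.
by rewrite lead_coefE size_falling_poly => ->; rewrite mulr1.
Qed.

Lemma file_coef_board_roots (m : nat) (s t : seq nat) : size s = size t ->
  file_coef m s =1 file_coef m t <->
  perm_eq (board_roots m s) (board_roots m t).
Proof.
move=> st; split=> [eq_st|].
  (* The multiset of roots is recovered over the field [rat], into which the integers embed. *)
  apply/(perm_map_inj (@intr_inj rat))/prod_XsubC_eq.
  have prodE u : \prod_(x <- map intr (board_roots m u)) ('X - x%:P) =
      map_poly intr (\prod_(r <- board_roots m u) ('X - r%:P)) :> {poly rat}.
    by rewrite map_prod_XsubC big_map.
  rewrite !prodE -!sum_file_coef st.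
  by congr map_poly; apply: eq_bigr => k _; rewrite eq_st.
move=> roots_st k; have [kn|nk] := leqP k (size t); last first.
  by rewrite !file_coef_eq0 ?st.
(* The index is reversed because the coefficient at [k] multiplies [falling_poly m (size t - k)]. *)
pose e j := file_coef m s (size t - j)%N - file_coef m t (size t - j)%N.
suff /falling_poly_free/(_ (size t - k)%N) :
    \sum_(j < (size t).+1) e j *: falling_poly m j = 0.
  by rewrite /e subKn // ltnS leq_subr => /(_ isT)/subr0_eq.
rewrite (reindex_inj rev_ord_inj) /=.
rewrite (eq_bigr (fun j : 'I_(size t).+1 =>
  file_coef m s j *: falling_poly m (size t - j) -
  file_coef m t j *: falling_poly m (size t - j))); last first.
  by move=> j _; rewrite subSS /e subKn -1?ltnS // scalerBl.
rewrite big_split sumrN /= sum_file_coef -st sum_file_coef.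
by rewrite (perm_big _ roots_st) subrr.
Qed.

(** * Roots of restricted boards *)

Lemma size_board_roots (m : nat) (s : seq nat) :
  size (board_roots m s) = size s.
Proof. by rewrite size_map size_iota. Qed.

Lemma nth_board_roots (m : nat) (s : seq nat) (i : nat) : (i < size s)%N ->
  nth 0 (board_roots m s) i = (i * m)%N%:Z - (nth 0%N s i)%:Z.
Proof. by move=> si; rewrite (nth_map 0%N) ?size_iota // nth_iota. Qed.

(** Consecutive roots differ by [m - (b_(i+1) - b_i)]. *)
Lemma sorted_board_roots (m : nat) (s : seq nat) :
  m_restricted m s -> sorted <=%O (board_roots m s).
Proof.
move=> rs; apply/(sortedP 0) => i; rewrite size_board_roots => si.
rewrite !nth_board_roots // ?(ltnW si) //; have := rs i si; lia.
Qed.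

Lemma restricted_board_roots_inj (m : nat) (s t : seq nat) :
  m_restricted m s -> m_restricted m t ->
  perm_eq (board_roots m s) (board_roots m t) -> s = t.
Proof.
move=> /sorted_board_roots ss /sorted_board_roots st pst.
have st_size : size s = size t.
  by rewrite -!(size_board_roots m) (perm_size pst).
apply: (@eq_from_nth _ 0%N) => // i si.
have := congr1 (nth 0 ^~ i) (le_sorted_eq ss st pst).
by rewrite !nth_board_roots -?st_size // => /addrI/oppr_inj[].
Qed.

(** * Empty columns on the left *)

Lemma ferrers_board_pad (p : nat) (B : seq nat) :
  ferrers_board B -> ferrers_board (nseq p 0%N ++ B).
Proof.
move=> fB; elim: p => //= p [s0 n0 sp]; split=> //=.
by rewrite path_min_sorted //; apply/allP.
Qed.

Lemma m_restricted_pad (m p : nat) (B : seq nat) :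
  ferrers_board B -> m_restricted m B -> m_restricted m (nseq p 0%N ++ B).
Proof.
move=> fB rB; elim: p => //= p IHp [_|j]; last exact: IHp.
by have [_ /= -> _] := ferrers_board_pad p fB.
Qed.

Lemma weight_file_equiv_roots (m : nat) (s t : seq nat) :
  sorted leq s -> sorted leq t -> size s = size t ->
  weight_file_equiv m s t <-> perm_eq (board_roots m s) (board_roots m t).
Proof.
move=> ss st /file_coef_board_roots <-.
by split=> e k; have := e k; rewrite !file_number_coef.
Qed.

Lemma weight_file_equiv_pad (m p : nat) (B : seq nat) :
  ferrers_board B -> weight_file_equiv m B (nseq p 0%N ++ B).
Proof.
move=> fB k; have [_ _ sB] := fB; have [_ _ spB] := ferrers_board_pad p fB.
by rewrite !file_number_coef // file_coef_pad.
Qed.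

(** * Restricted boards with prescribed roots *)

Lemma nth_sort_leq (t : seq nat) (i j : nat) : (i <= j < size t)%N ->
  (nth 0 (sort leq t) i <= nth 0 (sort leq t) j)%N.
Proof.
move=> /andP[ij jt].
apply: (sorted_leq_nth leq_trans leqnn 0%N (sort_sorted leq_total t)) => //;
  rewrite inE size_sort //; exact: leq_ltn_trans jt.
Qed.

(* The walk t reaches the level s_(j+1) from below; were the gap after s_j
   longer than m, its last value before that would lie inside the gap. *)
Lemma sort_step_le (m : nat) (t : seq nat) : nth 0%N t 0 = 0%N ->
  (forall j, (j.+1 < size t)%N -> (nth 0 t j.+1 <= nth 0 t j + m)%N) ->
  forall j, (j.+1 < size t)%N ->
    (nth 0 (sort leq t) j.+1 <= nth 0 (sort leq t) j + m)%N.
Proof.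
move=> t0 step j jt; set s := sort leq t; set v := nth 0%N s j.+1.
have ssize : size s = size t by rewrite size_sort.
rewrite leqNgt; apply/negP => gap.
have hv : has (leq v) t.
  by apply/hasP; exists v => //; rewrite -(mem_sort leq) mem_nth // ssize.
have := nth_find 0%N hv; have := @before_find _ 0%N (leq v) t.
move: hv; rewrite has_find; case: (find (leq v) t) => [|i] it before.
  by rewrite t0; lia.
move=> vi; have := before i (leqnn _); have := step i it => stepi.
move/negbT; rewrite -ltnNge => iv.
have : nth 0%N t i \in s by rewrite mem_sort mem_nth // ltnW.
case/(nthP 0%N) => l ls slti; have [lj|jl] := leqP l j.
  have : (nth 0 s l <= nth 0 s j)%N by rewrite nth_sort_leq // lj ltnW.
  by rewrite slti; lia.
have : (v <= nth 0 s l)%N by rewrite nth_sort_leq // jl -ssize.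
by rewrite slti; lia.
Qed.

(** With [s] the sorted roots, the heights must be [i m - s_i]. They increase weakly because [s]
    climbs by at most [m] at each step, and are restricted because [s] increases weakly. *)
Lemma restricted_board_of_roots (m : nat) (t : seq nat) :
  (0 < size t)%N -> nth 0%N t 0 = 0%N ->
  (forall j, (j.+1 < size t)%N -> (nth 0 t j.+1 <= nth 0 t j + m)%N) ->
  exists B, [/\ ferrers_board B, m_restricted m B &
                perm_eq (board_roots m B) (map Posz t)].
Proof.
move=> tpos t0 /(sort_step_le t0); set s := sort leq t => step.
have ssize : size s = size t by rewrite size_sort.
have s0 : nth 0%N s 0 = 0%N.
  have : nth 0%N t 0 \in s by rewrite mem_sort mem_nth.
  rewrite t0 => /(nthP 0%N)[l]; rewrite ssize => ls sl0.
  have : (nth 0 s 0 <= nth 0 s l)%N by rewrite nth_sort_leq.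
  by rewrite sl0 leqn0 => /eqP.
(* This makes the truncated subtraction [i * m - nth 0 s i] exact. *)
have bound j : (j < size t)%N -> (nth 0 s j <= j * m)%N.
  elim: j => [|j IHj] jt; first by rewrite s0.
  have := IHj (ltnW jt); have := step j jt; lia.
pose B := [seq (i * m - nth 0 s i)%N | i <- iota 0 (size t)].
have Bsize : size B = size t by rewrite size_map size_iota.
have nthB i : (i < size t)%N -> nth 0%N B i = (i * m - nth 0 s i)%N.
  by move=> it; rewrite (nth_map 0%N) ?size_iota // nth_iota.
exists B; split.
- split; rewrite ?Bsize ?nthB //.
  apply/(sortedP 0%N) => i; rewrite Bsize => it; rewrite !nthB ?(ltnW it) //.
  have := step i it; have := bound _ it; have := bound _ (ltnW it); lia.
- move=> j; rewrite Bsize => jt; rewrite !nthB ?(ltnW jt) //.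
  have := @nth_sort_leq t j j.+1; rewrite -/s.
  have := bound _ jt; have := bound _ (ltnW jt); lia.
rewrite (_ : board_roots m B = map Posz s).
  by rewrite perm_map // perm_sort.
apply: (@eq_from_nth _ 0); rewrite size_board_roots ?size_map size_iota //.
move=> i it.
rewrite nth_board_roots ?Bsize // nthB // (nth_map 0%N) ?ssize //.
have := bound _ it; lia.
Qed.

Theorem theorem7p3 (m : nat) (hm : (0 < m)%N) (B : seq nat)
    (hB : ferrers_board B) :
  exists B' : seq nat,
    [/\ ferrers_board B', m_restricted m B' & weight_file_equiv m B B'] /\
    (forall B'' : seq nat,
       ferrers_board B'' -> m_restricted m B'' -> weight_file_equiv m B B'' ->
       same_board B'' B').
Proof.
(* [N] is the largest height. After [N] empty columns every original column has index [i >= N], so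
   its height is at most [N <= i * m] and its root is nonnegative. *)
pose N := last 0%N B; pose A := nseq N 0%N ++ B.
have fA : ferrers_board A := ferrers_board_pad N hB.
have [Apos A0 sA] := fA.
have BA : weight_file_equiv m B A := weight_file_equiv_pad m N hB.
have A_le i : (i < size A)%N -> (nth 0 A i <= i * m)%N.
  move=> iA; case: (ltnP i N) => [iN|Ni].
    by rewrite nth_cat size_nseq iN nth_nseq iN.
  apply: (@leq_trans N); last by rewrite (leq_trans Ni) // leq_pmulr.
  have -> : N = nth 0%N A (size A).-1.
    by rewrite nth_last last_cat /N; case: (B) hB => [[]|].
  by apply: (sorted_leq_nth leq_trans leqnn 0%N sA); rewrite ?inE; lia.
pose t := [seq (i * m - nth 0 A i)%N | i <- iota 0 (size A)].
have tsize : size t = size A by rewrite size_map size_iota.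
have nth_t i : (i < size A)%N -> nth 0%N t i = (i * m - nth 0 A i)%N.
  by move=> iA; rewrite (nth_map 0%N) ?size_iota // nth_iota.
have [||j|B' [fB' rB' pB']] := @restricted_board_of_roots m t.
- by rewrite tsize.
- by rewrite nth_t // A0.
(* The heights of [A] increase weakly, so its roots climb by at most [m]. *)
- rewrite tsize => jA; rewrite !nth_t ?(ltnW jA) //.
  have := A_le _ jA; have := A_le _ (ltnW jA).
  have : (nth 0 A j <= nth 0 A j.+1)%N by move/(sortedP 0%N): sA; apply.
  lia.
have tA : map Posz t = board_roots m A.
  apply: (@eq_from_nth _ 0).
    by rewrite size_map tsize size_board_roots.
  rewrite size_map tsize => i iA.
  rewrite nth_board_roots // (nth_map 0%N) ?tsize // nth_t //.
  have := A_le _ iA; lia.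
rewrite tA in pB'.
have [_ _ sB'] := fB'.
have AB' : weight_file_equiv m A B'.
  apply/weight_file_equiv_roots => //; last by rewrite perm_sym.
  by rewrite -!(size_board_roots m) (perm_size pB').
have BB' : weight_file_equiv m B B' by move=> k; rewrite BA AB'.
exists B'; split=> // B'' fB'' rB'' BB''.
(* Padding each board by the length of the other equalizes the numbers of columns, so that their
   roots can be compared. *)
exists (size B'), (size B''); apply: (restricted_board_roots_inj (m := m)).
- exact: m_restricted_pad.
- exact: m_restricted_pad.
have [_ _ s1] := ferrers_board_pad (size B') fB''.
have [_ _ s2] := ferrers_board_pad (size B'') fB'.
apply/weight_file_equiv_roots => //.
  by rewrite !size_cat !size_nseq addnC.
move=> k; rewrite -weight_file_equiv_pad // -weight_file_equiv_pad //.
by rewrite -BB'' BB'.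
Qed.
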